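(* Let $\mathbf{z}_0$ be an $\mathbb{R}^d$-valued random vector with finite second moments, let $\boldsymbol{\epsilon}\sim\mathcal{N}(\mathbf{0},\mathbf{I})$ be independent of $\mathbf{z}_0$, let $0\le t'<t\le 1$, and let $\mathbf{z}_t=(1-t)\mathbf{z}_0+t\boldsymbol{\epsilon}$. Let $\hat{\mathbf{z}}_0(t)=\mathbb{E}[\mathbf{z}_0\mid\mathbf{z}_t]$ and $\hat{\boldsymbol{\epsilon}}(t)=\mathbb{E}[\boldsymbol{\epsilon}\mid\mathbf{z}_t]$. Let $k_1,k_2\in\mathbb{R}$ satisfy $k_1^2+k_2^2=t'^2$, let $\mathbf{w}\sim\mathcal{N}(\mathbf{0},\mathbf{I})$ be independent of $(\mathbf{z}_0,\boldsymbol{\epsilon})$, and define $$\mathbf{z}_{t'}^{\mathrm{CPS}}=(1-t')\hat{\mathbf{z}}_0(t)+k_1\hat{\boldsymbol{\epsilon}}(t)+k_2\mathbf{w},\qquad \mathbf{L}=(1-t')\mathbf{z}_0+k_1\boldsymbol{\epsilon}.$$ Then $$\operatorname{Cov}(\mathbf{z}_{t'}^{\mathrm{CPS}})=\operatorname{Cov}(\mathbf{L})-\mathbb{E}_{\mathbf{z}_t}\bigl[\operatorname{Cov}(\mathbf{L}\mid\mathbf{z}_t)\bigr]+k_2^2\mathbf{I}$$ and $$\operatorname{Cov}(\mathbf{z}_{t'}^{\mathrm{CPS}})\preceq(1-t')^2\operatorname{Cov}(\mathbf{z}_0)+t'^2\mathbf{I},$$ with strict trace contraction, i.e. $\operatorname{tr}\operatorname{Cov}(\mathbf{z}_{t'}^{\mathrm{CPS}})<\operatorname{tr}\bigl((1-t')^2\operatorname{Cov}(\mathbf{z}_0)+t'^2\mathbf{I}\bigr)$,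 whenever $\mathbb{E}_{\mathbf{z}_t}\bigl[\operatorname{tr}\operatorname{Cov}(\mathbf{L}\mid\mathbf{z}_t)\bigr]>0$.
   Context: $\operatorname{Cov}(\cdot\mid\mathbf{z}_t)$ is the conditional covariance matrix given $\mathbf{z}_t$, and $\preceq$ is the Loewner (positive semidefinite) order. The matrix $(1-t')^2\operatorname{Cov}(\mathbf{z}_0)+t'^2\mathbf{I}$ is the covariance of the flow-matching marginal $(1-t')\mathbf{z}_0+t'\boldsymbol{\epsilon}$ at time $t'$. The map from $\mathbf{z}_t$ to $\mathbf{z}_{t'}^{\mathrm{CPS}}$ is the coefficient-preserving sampling (CPS) transition. *)

(* Defs.v *)
From HB Require Import structures.
From mathcomp Require Import all_boot all_order all_algebra.
From mathcomp Require Import all_classical all_reals all_analysis.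
(* all_analysis alone loses the measurable structure of the extended reals. *)
From mathcomp Require Import measurable_realfun.

Set Implicit Arguments.
Unset Strict Implicit.
Unset Printing Implicit Defensive.

Import Order.TTheory GRing.Theory Num.Theory.
Import numFieldNormedType.Exports.

Local Open Scope classical_set_scope.
Local Open Scope ring_scope.

(* The Borel sigma-algebra of R^d, presented as the one generated by the
   coordinates, as the library does for [d.-tuple R]. *)
Section measurable_colvec.
Context {R : realType} (d : nat).

Let coord (i : 'I_d) (x : 'cV[R]_d) : R := x i 0.

Let colvec_set0 : g_sigma_preimage coord set0.
Proof. exact: sigma_algebra0. Qed.

Let colvec_setC A : g_sigma_preimage coord A -> g_sigma_preimage coord (~` A).
Proof. exact: sigma_algebraC. Qed.

Let colvec_bigcup (F : (set 'cV[R]_d)^nat) :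
  (forall i, g_sigma_preimage coord (F i)) ->
  g_sigma_preimage coord (\bigcup_i (F i)).
Proof. exact: sigma_algebra_bigcup. Qed.

HB.instance Definition _ := @isMeasurable.Build default_measure_display
  'cV[R]_d (g_sigma_preimage coord) colvec_set0 colvec_setC colvec_bigcup.

End measurable_colvec.

Section probability_notions.
Context {disp : measure_display} {T : measurableType disp} {R : realType}.
Variable P : probability T R.

Definition independent_RV {d1 d2 : measure_display} {T1 : measurableType d1}
    {T2 : measurableType d2} (X : T -> T1) (Y : T -> T2) : Prop :=
  forall A B, measurable A -> measurable B ->
    (P (X @^-1` A `&` Y @^-1` B) = P (X @^-1` A) * P (Y @^-1` B))%E.

(* X ~ N(0, I_d): the law of X is the d-fold product of N(0, 1), tested on
   measurable boxes. *)
Definition std_normal_vec {d : nat} (X : T -> 'cV[R]_d) : Prop :=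
  forall A : 'I_d -> set R, (forall i, measurable (A i)) ->
    (P [set w | forall i, A i (X w i ord0)] =
     \big[*%E/1]_(i < d) normal_prob 0 1 (A i))%E.

Definition square_integrable {d : nat} (X : T -> 'cV[R]_d) : Prop :=
  forall i, (fun w => X w i ord0) \in Lfun P 2%:E.

(* [fine] sends infinite values to 0; it is only used on entries that are
   finite for square-integrable X and integrable M respectively. *)
Definition cov_mx {d : nat} (X : T -> 'cV[R]_d) : 'M[R]_d :=
  \matrix_(i, j)
    fine (covariance P (fun w => X w i ord0) (fun w => X w j ord0)).

Definition expect_mx {m n : nat} (M : T -> 'M[R]_(m, n)) : 'M[R]_(m, n) :=
  \matrix_(i, j) fine ('E_P[fun w => M w i j])%E.

(* Z is a version of E[X | Y] = E[X | sigma(Y)], for an integrable X. *)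
Definition is_cond_exp {d' : measure_display} {T' : measurableType d'}
    (Y : T -> T') (X Z : T -> R) : Prop :=
  [/\ measurable_fun [set: g_sigma_algebra_preimageType Y] Z,
      P.-integrable [set: T] (EFin \o Z) &
      forall A, g_sigma_algebra_preimage Y A ->
        (\int[P]_(w in A) (Z w)%:E = \int[P]_(w in A) (X w)%:E)%E].

Definition is_cond_exp_mx {d' : measure_display} {T' : measurableType d'}
    (Y : T -> T') {m n : nat} (X Z : T -> 'M[R]_(m, n)) : Prop :=
  forall i j, is_cond_exp Y (fun w => X w i j) (fun w => Z w i j).

(* C is a version of Cov(X | Y) = E[(X - E[X|Y]) (X - E[X|Y])^T | Y]. *)
Definition is_cond_cov {d' : measure_display} {T' : measurableType d'}
    (Y : T -> T') {d : nat} (X : T -> 'cV[R]_d) (C : T -> 'M[R]_d) : Prop :=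
  exists2 m : T -> 'cV[R]_d, is_cond_exp_mx Y X m &
    is_cond_exp_mx Y (fun w => (X w - m w) *m (X w - m w)^T) C.

Lemma is_cond_exp_ex {d' : measure_display} {T' : measurableType d'}
    (Y : T -> T') (X : T -> R) :
  measurable_fun [set: T] Y -> P.-integrable [set: T] (EFin \o X) ->
  exists Z, is_cond_exp Y X Z.
Proof.
move=> mY iX.
pose S : measurableType _ := g_sigma_algebra_preimageType Y.
have subP A : g_sigma_algebra_preimage Y A -> measurable A.
  by move=> [B mB <-]; exact: mY.
have mi : measurable_fun [set: T] (idfun : T -> S).
  by move=> _ A mA; rewrite setTI; exact: subP.
pose i_ : {mfun T >-> S} := mfun_Sub (mem_set mi).
pose mu : probability S R := distribution P i_.
pose nu : {charge set S -> \bar R} :=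
  measure_function_pushforward__canonical__charge_Charge (induced_charge iX) mi.
have numu : nu `<< mu.
  apply/null_content_dominatesP => A mA A0.
  apply: null_set_integral; [exact: subP| |exact: A0].
  exact/measurable_funTS/(measurable_int _ iX).
pose f := Radon_Nikodym nu mu.
have mf : measurable_fun [set: S] f.
  exact: measurable_int (Radon_Nikodym_integrable numu).
have mfT : measurable_fun [set: T] (f : T -> \bar R).
  exact: measurableT_comp mf mi.
have fE w : (fine (f w))%:E = f w by rewrite fineK// Radon_Nikodym_fin_num.
have iF : P.-integrable [set: T] (f : T -> \bar R).
  apply/integrableP; split=> //.
  have /integrableP[_] := Radon_Nikodym_integrable numu.
  rewrite (ge0_integral_pushforward mi P) ?preimage_setT//.
  exact: measurableT_comp.
exists (fine \o f); split.
- exact: measurableT_comp.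
- by rewrite (_ : EFin \o _ = f)//; apply/funext => w /=; rewrite fE.
- move=> A mA; rewrite -[RHS]/(nu A) (Radon_Nikodym_integral numu mA) -/f.
  rewrite (integral_pushforward mi mf _ mA).
    by apply: eq_integral => w _; exact: fE.
  exact: integrableS (subP _ mA) _ iF.
Qed.

End probability_notions.

Definition psd {R : realType} {d : nat} (M : 'M[R]_d) : Prop :=
  M^T = M /\ forall v : 'cV[R]_d, 0 <= (v^T *m M *m v) ord0 ord0.

Definition loewner_le {R : realType} {d : nat} (A B : 'M[R]_d) : Prop :=
  psd (B - A).

(* Main.v *)
Require Import Defs.
From HB Require Import structures.
From mathcomp Require Import all_boot all_order all_algebra.
From mathcomp Require Import all_classical all_reals all_analysis.
From mathcomp Require Import measurable_realfun.
From mathcomp Require Import ring lra.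

Set Implicit Arguments.
Unset Strict Implicit.
Unset Printing Implicit Defensive.

Import Order.TTheory GRing.Theory Num.Theory.
Import numFieldNormedType.Exports.

Local Open Scope classical_set_scope.
Local Open Scope ring_scope.

(* Write L^ := (1 - t') z0^ + k1 eps^, a version of E[L | zt]. Since the noise w
   is independent of L^, a function of zt, Cov(zCPS) = Cov(L^) + k2^2 I,
   and the law of total covariance gives Cov(L^) = Cov(L) - E[Cov(L | zt)].
   As Cov(L) = (1 - t')^2 Cov(z0) + k1^2 I and k1^2 + k2^2 = t'^2, the gap
   between the flow-matching covariance and Cov(zCPS) is exactly
   E[Cov(L | zt)], the Gram matrix of the prediction error L - L^. *)

(** Conditional expectation, independence and normality are all given by their values on sets,
    whereas the argument needs expectations of products. One transfer principle,
    [eq_integral_weighted], bridges this: two weighted measures that agree on preimages give the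
    same integral to every nonnegative measurable function. It is instantiated for the pull-out
    property, for the product formula under independence, and for the normal density. Its
    restriction to nonnegative functions explains the recurring splittings into nonnegative parts. A
    second obstacle is that a version of a conditional expectation is only assumed integrable; its
    square integrability, on which the covariances of [z0hat] and [epshat] rest, is derived by
    truncation. Finally, the conditional mean hidden in [is_cond_cov] is an arbitrary version,
    chosen independently of [Lhat]; orthogonality makes the choice irrelevant inside
    expectations. *)

(** * Transfer of integrals between weighted measures *)

Section weighted_integral.
Context {d d' : measure_display} {T : measurableType d} {S : measurableType d'}.
Context {R : realType} (mu : {measure set T -> \bar R}).
Variables (g : T -> S) (X : T -> R) (f : S -> R).
Hypotheses (mg : measurable_fun [set: T] g) (mX : measurable_fun [set: T] X).
Hypotheses (X0 : forall x, 0 <= X x) (f0 : forall y, 0 <= f y).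
Hypothesis mf : measurable_fun [set: S] f.

Import HBNNSimple.

Let mEf : measurable_fun [set: S] (EFin \o f).
Proof. exact/measurable_EFinP. Qed.

Let integral_weighted_nnsfun (h : {nnsfun S >-> R}) :
  (\int[mu]_x (X x * h (g x))%:E =
   \sum_(r \in range h)
      r%:E * \int[mu]_(x in g @^-1` (h @^-1` [set r])) (X x)%:E)%E.
Proof.
have mind r : measurable_fun [set: T] (fun x => \1_(h @^-1` [set r]) (g x) : R).
  by apply: measurableT_comp => //; exact: measurable_indic.
transitivity (\int[mu]_x (\sum_(r \in range h)
    (X x * (r * \1_(h @^-1` [set r]) (g x)))%:E)%E)%E.
  by apply: eq_integral => x _; rewrite fimfunE mulr_fsumr -?fsumEFin.
rewrite ge0_integral_fsum//; last 2 first.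
- move=> r; apply/measurable_EFinP; apply: measurable_funM => //.
  exact: measurable_funM.
- move=> r x _; rewrite lee_fin mulr_ge0 ?X0 //.
  by rewrite -lee_fin EFinM nnfun_muleindic_ge0.
apply: eq_fsbigr => r; rewrite inE => -[y _ <-].
rewrite -ge0_integralZl//; last 4 first.
- by rewrite -[_ @^-1` _]setTI; exact: mg.
- exact/measurable_EFinP/measurable_funTS.
- by move=> x _; rewrite lee_fin.
- by rewrite lee_fin.
rewrite [RHS]integral_mkcond; apply: eq_integral => x _.
rewrite patchE indicE; case: ifPn => xA.
  have -> : g x \in h @^-1` [set h y] by move: xA; rewrite !inE.
  by rewrite mulr1 EFinM muleC.
have -> : g x \in h @^-1` [set h y] = false.
  by apply/negbTE; move: xA; rewrite !notin_setE.
by rewrite !mulr0.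
Qed.

(** The point is the shape of the right-hand side: it involves [mu], [g] and [X] only through the
    masses of [X] on preimages under [g], so it can be compared across different spaces. *)
Lemma integral_weighted_approx :
  (\int[mu]_x (X x * f (g x))%:E = limn (fun n =>
     \sum_(r \in range (nnsfun_approx measurableT mEf n))
      r%:E * \int[mu]_(x in g @^-1`
        (nnsfun_approx measurableT mEf n @^-1` [set r])) (X x)%:E))%E.
Proof.
under [in RHS]eq_fun do rewrite -integral_weighted_nnsfun.
have f0' x : [set: S] x -> (0 <= (EFin \o f) x)%E by rewrite lee_fin.
rewrite -monotone_convergence//=.
- apply: eq_integral => x _; apply/esym/cvg_lim => //.
  under eq_fun do rewrite EFinM.
  rewrite EFinM; apply: cvgeZl => //; exact: cvg_nnsfun_approx.
- move=> n; apply/measurable_EFinP; apply: measurable_funM => //.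
  exact: measurableT_comp.
- by move=> n x _; rewrite lee_fin mulr_ge0.
- move=> x _ m n mn; rewrite lee_fin ler_wpM2l//.
  exact/lefP/nd_nnsfun_approx.
Qed.

End weighted_integral.

Section eq_integral_weighted.
Import HBNNSimple.

(** The hypothesis says that the measures with densities [X1] and [X2] have the same image on [S].
    No finiteness is required: both integrals may be infinite. *)
Lemma eq_integral_weighted {d1 d2 d' : measure_display}
    {T1 : measurableType d1} {T2 : measurableType d2} {S : measurableType d'}
    {R : realType} (mu1 : {measure set T1 -> \bar R})
    (mu2 : {measure set T2 -> \bar R})
    (g1 : T1 -> S) (g2 : T2 -> S) (X1 : T1 -> R) (X2 : T2 -> R) (f : S -> R) :
  measurable_fun [set: T1] g1 -> measurable_fun [set: T2] g2 ->
  measurable_fun [set: T1] X1 -> measurable_fun [set: T2] X2 ->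
  (forall x, 0 <= X1 x) -> (forall x, 0 <= X2 x) ->
  (forall A, measurable A -> (\int[mu1]_(x in g1 @^-1` A) (X1 x)%:E =
     \int[mu2]_(x in g2 @^-1` A) (X2 x)%:E)%E) ->
  measurable_fun [set: S] f -> (forall y, 0 <= f y) ->
  (\int[mu1]_x (X1 x * f (g1 x))%:E = \int[mu2]_x (X2 x * f (g2 x))%:E)%E.
Proof.
move=> mg1 mg2 mX1 mX2 X10 X20 X12 mf f0.
rewrite (integral_weighted_approx _ mg1)// (integral_weighted_approx _ mg2)//.
apply/congr_lim/funext => n; apply: eq_fsbigr => r _; congr (_ * _)%E.
by apply: X12; exact: measurable_funPTI.
Qed.

End eq_integral_weighted.

(** * Integrability of real functions, measurability of column vectors, square integrability *)

Section integrable_EFin.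
Context {d : measure_display} {T : measurableType d} {R : realType}.
Context {mu : {measure set T -> \bar R}} {D : set T}.
Hypothesis mD : measurable D.
Implicit Types f g : T -> R.

Lemma integrable_EFinD f g :
  mu.-integrable D (EFin \o f) -> mu.-integrable D (EFin \o g) ->
  mu.-integrable D (EFin \o (fun x => f x + g x)).
Proof. by move=> mf mg; exact: integrableD mf mg. Qed.

Lemma integrable_EFinB f g :
  mu.-integrable D (EFin \o f) -> mu.-integrable D (EFin \o g) ->
  mu.-integrable D (EFin \o (fun x => f x - g x)).
Proof. by move=> mf mg; exact: integrableB mf mg. Qed.

Lemma integrable_EFinZ (k : R) f : mu.-integrable D (EFin \o f) ->
  mu.-integrable D (EFin \o (fun x => k * f x)).
Proof. by move=> mf; exact: (integrableZl mD k mf). Qed.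

Lemma integrable_EFin_measurable f :
  mu.-integrable D (EFin \o f) -> measurable_fun D f.
Proof. by move=> /measurable_int/measurable_EFinP. Qed.

Lemma integrable_EFin_le f g : measurable_fun D f ->
  (forall x, D x -> `|f x| <= `|g x|) ->
  mu.-integrable D (EFin \o g) -> mu.-integrable D (EFin \o f).
Proof. by move=> mf fg; apply: le_integrable => //; exact/measurable_EFinP. Qed.

End integrable_EFin.

Lemma measurable_coord {R : realType} {n : nat} (i : 'I_n) :
  measurable_fun [set: 'cV[R]_n] (fun x : 'cV[R]_n => x i ord0).
Proof.
move=> _ A mA; rewrite setTI; apply: sub_sigma_algebra => /=.
rewrite -bigcup_seq/=; exists i => /=; first by rewrite mem_index_enum.
by exists A => //; rewrite setTI.
Qed.

Lemma measurable_colvec {d : measure_display} {T : measurableType d}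
    {R : realType} {n : nat} (f : T -> 'cV[R]_n) :
  (forall i, measurable_fun [set: T] (fun x => f x i ord0)) ->
  measurable_fun [set: T] f.
Proof.
move=> mf; apply: measurability; first reflexivity.
move=> _ [B + <-].
rewrite -bigcup_seq/= => -[i _ [A mA <-]].
by rewrite setTI; exact: mf.
Qed.

Lemma measurable_colvec_linear {R : realType} {n : nat} (a b : R) :
  measurable_fun [set: 'cV[R]_n * 'cV[R]_n] (fun x => a *: x.1 + b *: x.2).
Proof.
apply: measurable_colvec => i.
rewrite (_ : (fun x => _) = (fun x : 'cV[R]_n * 'cV[R]_n =>
  a * x.1 i ord0 + b * x.2 i ord0)); last by apply/funext => x; rewrite !mxE.
by apply: measurable_funD; apply: measurable_funM => //;
  apply: (measurableT_comp (measurable_coord i)).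
Qed.

Lemma Lfun2_intro {d : measure_display} {T : measurableType d} {R : realType}
    (mu : {measure set T -> \bar R}) (X : T -> R) :
  measurable_fun [set: T] X -> (\int[mu]_x (X x ^+ 2)%:E < +oo)%E ->
  X \in Lfun mu 2%:E.
Proof.
move=> mX X2; rewrite inE; apply/andP; split; rewrite inE//=.
rewrite /finite_norm unlock poweR_lty//.
apply: le_lt_trans X2; rewrite le_eqVlt; apply/orP; left; apply/eqP.
apply: eq_integral => x _ /=; congr EFin.
by rewrite powR_mulrn ?real_normK ?num_real.
Qed.

Section Lfun2_probability.
Context {disp : measure_display} {T : measurableType disp} {R : realType}.
Variable P : probability T R.
Implicit Types X Y : T -> R.

Local Notation int f := (P.-integrable [set: T] (EFin \o f)).
Local Notation L2 X := (X \in Lfun P 2%:E).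

Lemma Lfun2_integrable X : L2 X -> int X.
Proof.
by move=> X2; apply/Lfun1_integrable/Lfun_subset12; rewrite ?fin_num_measure.
Qed.

Lemma Lfun2_integrableM X Y : L2 X -> L2 Y -> int (fun x => X x * Y x).
Proof. by move=> X2 Y2; apply/Lfun1_integrable; exact: Lfun2_mul_Lfun1. Qed.

End Lfun2_probability.

(** * The pull-out property of conditional expectation *)

Section conditional_expectation.
Context {disp d' : measure_display} {T : measurableType disp}.
Context {T' : measurableType d'} {R : realType} (P : probability T R).
Variable Y : T -> T'.
Hypothesis mY : measurable_fun [set: T] Y.
Implicit Types X Z W : T -> R.

Local Notation S := (g_sigma_algebra_preimageType Y).
Local Notation int f := (P.-integrable [set: T] (EFin \o f)).

Lemma g_sigma_algebra_preimage_measurable A :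
  g_sigma_algebra_preimage Y A -> measurable A.
Proof. by move=> [B mB <-]; exact: mY. Qed.

Lemma measurable_g_sigma_algebra_preimage W :
  measurable_fun [set: S] W -> measurable_fun [set: T] W.
Proof.
move=> mW _ A mA; rewrite setTI; apply: g_sigma_algebra_preimage_measurable.
by have := mW measurableT A mA; rewrite setTI.
Qed.

Lemma cond_exp_pullout_ge0 X Z W : is_cond_exp P Y X Z -> int X ->
  measurable_fun [set: S] W -> (forall x, 0 <= W x) ->
  int (fun x => X x * W x) -> int (fun x => Z x * W x) ->
  \int[P]_x (X x * W x) = \int[P]_x (Z x * W x).
Proof.
(* The transfer principle is applied along the identity from [T] to [S], the same set with the
   sigma-algebra generated by [Y]: agreement on preimages is then the defining property of a
   conditional expectation. *)
move=> [mZ iZ XZ] iX mW W0 iXW iZW.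
have mi : measurable_fun [set: T] (idfun : T -> S).
  move=> _ A mA; rewrite setTI; exact: g_sigma_algebra_preimage_measurable.
(* Adding [V] to both variables makes them nonnegative. *)
pose V x := `|X x| + `|Z x|.
have iV : int V.
  by apply: (integrable_EFinD measurableT); exact: integrable_norm.
have iVW : int (fun x => V x * W x).
  have := integrable_EFinD measurableT
    (integrable_norm iXW) (integrable_norm iZW).
  apply: eq_integrable => // x _ /=.
  by rewrite /V mulrDl !normrM (ger0_norm (W0 x)).
have mX : measurable_fun [set: T] X by exact: integrable_EFin_measurable iX.
have mZ' : measurable_fun [set: T] Z.
  exact: integrable_EFin_measurable iZ.
have mV : measurable_fun [set: T] V.
  exact: integrable_EFin_measurable iV.
have V0 x : (0 <= X x + V x) /\ (0 <= Z x + V x).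
  have := ler_norm (- X x); have := ler_norm (- Z x); rewrite !normrN /V.
  have := normr_ge0 (X x); have := normr_ge0 (Z x); lra.
have eqA (A : set S) : measurable A ->
    (\int[P]_(x in idfun @^-1` A) (X x + V x)%:E =
     \int[P]_(x in idfun @^-1` A) (Z x + V x)%:E)%E.
  move=> mA; rewrite preimage_id.
  have mA' : disp.-measurable (A : set T).
    exact: g_sigma_algebra_preimage_measurable.
  have iA f : int f -> P.-integrable (A : set T) (EFin \o f).
    by apply: integrableS.
  under eq_integral do rewrite EFinD.
  under [RHS]eq_integral do rewrite EFinD.
  by rewrite (integralD mA' (iA _ iX) (iA _ iV))
             (integralD mA' (iA _ iZ) (iA _ iV)) XZ.
have := @eq_integral_weighted _ _ _ T T S R P P idfun idfun
  (fun x => X x + V x) (fun x => Z x + V x) W mi mi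
  (measurable_funD mX mV) (measurable_funD mZ' mV)
  (fun x => (V0 x).1) (fun x => (V0 x).2) eqA mW W0.
(* All integrals are finite, so the common contribution of [V] cancels. *)
move=> /(congr1 fine); rewrite -!/(Rintegral _ _ _).
under eq_Rintegral do rewrite mulrDl.
under [X in _ = X -> _]eq_Rintegral do rewrite mulrDl.
by rewrite !RintegralD// => /addIr.
Qed.

(** A signed [W] is the difference of [W] plus its absolute value and its absolute value, both
    nonnegative and measurable for the sigma-algebra of [Y]; the products with [X] and [Z] stay
    integrable because absolute values are preserved. *)
Lemma cond_exp_pullout X Z W : is_cond_exp P Y X Z -> int X ->
  measurable_fun [set: S] W ->
  int (fun x => X x * W x) -> int (fun x => Z x * W x) ->
  \int[P]_x (X x * W x) = \int[P]_x (Z x * W x).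
Proof.
move=> XZ iX mW iXW iZW.
have iabs U : int (fun x => U x * W x) -> measurable_fun [set: T] U ->
    int (fun x => U x * `|W x|).
  move=> iUW mU; apply: integrable_EFin_le iUW => //.
    apply: measurable_funM => //.
    apply: measurableT_comp => //.
    exact: measurable_g_sigma_algebra_preimage.
  by move=> x _; rewrite /= !normrM normr_id.
have mX : measurable_fun [set: T] X by exact: integrable_EFin_measurable iX.
have mZ : measurable_fun [set: T] Z.
  by case: XZ => _ iZ _; exact: integrable_EFin_measurable iZ.
have iXa := iabs X iXW mX.
have iZa := iabs Z iZW mZ.
have split U : int (fun x => U x * W x) -> int (fun x => U x * `|W x|) ->
    int (fun x => U x * (W x + `|W x|)) /\
    \int[P]_x (U x * W x) =
    \int[P]_x (U x * (W x + `|W x|)) - \int[P]_x (U x * `|W x|).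
  move=> i1 i2; split.
    apply: eq_integrable (integrable_EFinD measurableT i1 i2) => // x _ /=.
    by rewrite mulrDr.
  under [X in _ = X - _]eq_Rintegral do rewrite mulrDr.
  by rewrite RintegralD// addrK.
have [iX2 ->] := split X iXW iXa.
have [iZ2 ->] := split Z iZW iZa.
have mN : measurable_fun [set: S] (fun x => `|W x|) by exact: measurableT_comp.
rewrite (cond_exp_pullout_ge0 XZ iX _ _ iX2 iZ2).
- by rewrite (cond_exp_pullout_ge0 XZ iX mN _ iXa iZa).
- exact: measurable_funD.
- move=> x; have := ler_norm (- W x); rewrite normrN; lra.
Qed.

End conditional_expectation.

(** * Conditional expectation of square-integrable variables *)

Section conditional_expectation_L2.
Context {disp d' : measure_display} {T : measurableType disp}.
Context {T' : measurableType d'} {R : realType} (P : probability T R).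
Variable Y : T -> T'.
Hypothesis mY : measurable_fun [set: T] Y.
Implicit Types X Z W : T -> R.

Local Notation S := (g_sigma_algebra_preimageType Y).
Local Notation int f := (P.-integrable [set: T] (EFin \o f)).

(** Values outside the interval are sent to 0 rather than clipped to its ends, so that
    [z * trunc n z = trunc n z ^+ 2]. *)
Let trunc (n : nat) (z : R) : R := z * \1_(`[- n%:R, n%:R]%classic) z.

Let truncE n z : trunc n z = if `|z| <= n%:R then z else 0.
Proof.
rewrite /trunc indicE ler_norml; case: ifPn => zn.
  by rewrite mem_set ?mulr1//= in_itv.
by rewrite memNset ?mulr0//= in_itv/=; exact/negP.
Qed.

Lemma cond_exp_Lfun2 X Z : is_cond_exp P Y X Z -> X \in Lfun P 2%:E ->
  Z \in Lfun P 2%:E.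
Proof.
move=> XZ X2; have [mZ iZ _] := XZ; have iX := Lfun2_integrable X2.
have mZT := integrable_EFin_measurable iZ.
have mX := integrable_EFin_measurable iX.
have mtrunc n : measurable_fun [set: R] (trunc n).
  by apply: measurable_funM => //; exact: measurable_indic.
have mW n : measurable_fun [set: S] (trunc n \o Z).
  exact: measurableT_comp.
have mWT n : measurable_fun [set: T] (trunc n \o Z).
  exact: measurableT_comp.
have intM n U : int U -> int (fun x => U x * trunc n (Z x)).
  move=> iU; have mU := integrable_EFin_measurable iU.
  apply: integrable_EFin_le (integrable_EFinZ measurableT n%:R iU) => //.
    by apply: measurable_funM => //; exact: mWT.
  move=> x _; rewrite [leLHS]normrM [leRHS]normrM mulrC ler_wpM2r// truncE.
  by case: ifPn; rewrite ?normr0 normr_nat.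
have sqE n z : z * trunc n z = trunc n z ^+ 2.
  by rewrite truncE; case: ifP; rewrite ?mulr0 ?expr0n ?expr2.
have iX2 : int (fun x => X x ^+ 2) by exact: Lfun2_integrable_sqr.
have iW2 n : int (fun x => trunc n (Z x) ^+ 2).
  apply: eq_integrable (intM n Z iZ) => // x _ /=.
  by rewrite sqE.
(* E[W^2] = E[X W] <= (E[X^2] + E[W^2]) / 2 for the truncation W of Z; the
   truncation makes E[W^2] finite, so that it can be cancelled. *)
have bound n : \int[P]_x (trunc n (Z x) ^+ 2) <= \int[P]_x (X x ^+ 2).
  have : \int[P]_x (X x * trunc n (Z x)) = \int[P]_x (trunc n (Z x) ^+ 2).
    rewrite (cond_exp_pullout mY XZ iX (mW n) (intM n X iX) (intM n Z iZ)).
    by apply: eq_Rintegral => x _; rewrite /= sqE.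
  have : \int[P]_x (2 * (X x * trunc n (Z x))) <=
         \int[P]_x (X x ^+ 2 + trunc n (Z x) ^+ 2).
    apply: le_Rintegral => //.
    - by apply: integrable_EFinZ => //; exact: intM.
    - exact: integrable_EFinD.
    - move=> x _; have := sqr_ge0 (X x - trunc n (Z x)); lra.
  rewrite RintegralD// RintegralZl//; last exact: intM.
  lra.
apply: Lfun2_intro => //.
apply: (@le_lt_trans _ _ (\int[P]_x (X x ^+ 2))%:E); last exact: ltry.
(* Monotone convergence removes the truncation: the squares increase with [n] and are eventually
   equal to [Z x ^+ 2], so the uniform bound passes to the limit. *)
have cvgZ : (\int[P]_x (trunc n (Z x) ^+ 2)%:E)%E @[n --> \oo] -->
    (\int[P]_x (Z x ^+ 2)%:E)%E.
  rewrite (eq_integral (fun x => limn (fun n => (trunc n (Z x) ^+ 2)%:E))).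
    apply: cvg_monotone_convergence => //.
    - move=> n; apply/measurable_EFinP; apply: measurable_funX; exact: mWT.
    - by move=> n x _; rewrite lee_fin sqr_ge0.
    - move=> x _ m n mn; rewrite lee_fin !truncE.
      case: ifPn => [zm|_]; last by rewrite expr0n sqr_ge0.
      by rewrite ifT// (le_trans zm)// ler_nat.
  move=> x _; apply/esym/cvg_lim => //; apply: cvg_near_cst; near=> n.
  by rewrite truncE ifT//; near: n; exact: nbhs_infty_ger.
rewrite -(cvg_lim _ cvgZ)//; apply: lime_le; first exact: cvgP cvgZ.
apply: nearW => n.
rewrite -(@fineK _ (\int[P]_x (trunc n (Z x) ^+ 2)%:E)%E) ?lee_fin ?bound//.
exact: integrable_fin_num (iW2 n).
Unshelve. all: by end_near. Qed.

Lemma cond_exp_orthogonal X Z W : is_cond_exp P Y X Z -> X \in Lfun P 2%:E ->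
  measurable_fun [set: S] W -> W \in Lfun P 2%:E ->
  \int[P]_x (X x * W x) = \int[P]_x (Z x * W x).
Proof.
move=> XZ X2 mW W2; apply: (cond_exp_pullout mY XZ) => //.
- exact: Lfun2_integrable.
- exact: Lfun2_integrableM.
- by apply: Lfun2_integrableM => //; exact: (cond_exp_Lfun2 XZ X2).
Qed.

Lemma cond_exp_expectation X Z : is_cond_exp P Y X Z ->
  \int[P]_x X x = \int[P]_x Z x.
Proof.
move=> [_ _ /(_ [set: T])]; rewrite /Rintegral => -> //.
by exists [set: T'] => //; rewrite preimage_setT setTI.
Qed.

Lemma cond_exp_linear (a b : R) X1 X2 Z1 Z2 :
  int X1 -> int X2 -> is_cond_exp P Y X1 Z1 -> is_cond_exp P Y X2 Z2 ->
  is_cond_exp P Y (fun x => a * X1 x + b * X2 x)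
                  (fun x => a * Z1 x + b * Z2 x).
Proof.
move=> iX1 iX2 [mZ1 iZ1 XZ1] [mZ2 iZ2 XZ2]; split.
- by apply: measurable_funD; apply: measurable_funM.
- by apply: integrable_EFinD => //; exact: integrable_EFinZ.
move=> A mA.
have mA' : measurable A by exact: g_sigma_algebra_preimage_measurable mA.
have iA f : int f -> P.-integrable A (EFin \o f) by apply: integrableS.
have E (f g : T -> R) : int f -> int g ->
    (\int[P]_(x in A) (a * f x + b * g x)%:E =
     a%:E * \int[P]_(x in A) (f x)%:E + b%:E * \int[P]_(x in A) (g x)%:E)%E.
  move=> fi gi; rewrite -(integralZl mA' (iA f fi)) -(integralZl mA' (iA g gi)).
  rewrite -integralD//; [exact: (integrableZl mA' a (iA f fi))|].
  exact: (integrableZl mA' b (iA g gi)).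
by rewrite !E// XZ1// XZ2.
Qed.

(* Two versions of a conditional expectation need not be compared almost
   everywhere: each of them can be traded for the other inside expectations
   by orthogonality. *)
Lemma cond_exp_version_mul X1 X2 Z1 Z2 W1 W2 :
  X1 \in Lfun P 2%:E -> X2 \in Lfun P 2%:E ->
  is_cond_exp P Y X1 Z1 -> is_cond_exp P Y X1 W1 ->
  is_cond_exp P Y X2 Z2 -> is_cond_exp P Y X2 W2 ->
  \int[P]_x (Z1 x * Z2 x) = \int[P]_x (W1 x * W2 x).
Proof.
move=> X12 X22 XZ1 XW1 XZ2 XW2.
have Z22 := cond_exp_Lfun2 XZ2 X22.
have W12 := cond_exp_Lfun2 XW1 X12.
have [mZ2 _ _] := XZ2; have [mW1 _ _] := XW1.
rewrite -(cond_exp_orthogonal XZ1 X12 mZ2 Z22).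
rewrite (cond_exp_orthogonal XW1 X12 mZ2 Z22).
under eq_Rintegral do rewrite mulrC.
under [RHS]eq_Rintegral do rewrite mulrC.
by rewrite -(cond_exp_orthogonal XZ2 X22 mW1 W12)
           (cond_exp_orthogonal XW2 X22 mW1 W12).
Qed.

Lemma cond_exp_error_mul X1 X2 Z1 Z2 :
  X1 \in Lfun P 2%:E -> X2 \in Lfun P 2%:E ->
  is_cond_exp P Y X1 Z1 -> is_cond_exp P Y X2 Z2 ->
  \int[P]_x ((X1 x - Z1 x) * (X2 x - Z2 x)) =
  \int[P]_x (X1 x * X2 x) - \int[P]_x (Z1 x * Z2 x).
Proof.
move=> X12 X22 XZ1 XZ2.
have Z12 := cond_exp_Lfun2 XZ1 X12; have Z22 := cond_exp_Lfun2 XZ2 X22.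
have [mZ1 _ _] := XZ1; have [mZ2 _ _] := XZ2.
have o1 := cond_exp_orthogonal XZ1 X12 mZ2 Z22.
have o2 := cond_exp_orthogonal XZ2 X22 mZ1 Z12.
(* The grouping matches orthogonality: the last bracket integrates to 0, and in the first one
   [X1 * Z2] may be replaced by [Z1 * Z2]. *)
transitivity (\int[P]_x
    (X1 x * X2 x - X1 x * Z2 x - (X2 x * Z1 x - Z2 x * Z1 x))).
  by apply: eq_Rintegral => x _; ring.
have i1 := Lfun2_integrableM X12 X22; have i2 := Lfun2_integrableM X12 Z22.
have i3 := Lfun2_integrableM X22 Z12; have i4 := Lfun2_integrableM Z22 Z12.
rewrite !RintegralB//; [|exact: integrable_EFinB..].
by rewrite o1 o2 subrr subr0.
Qed.

End conditional_expectation_L2.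

(** * Product formula for independent variables *)

Section independence.
Context {disp : measure_display} {T : measurableType disp} {R : realType}.
Variable P : probability T R.
Implicit Types X Y : T -> R.

Local Notation int f := (P.-integrable [set: T] (EFin \o f)).

(** Two transfers, one variable at a time. Along [X], independence makes the indicator of a
    [Y]-event interchangeable with its probability; this gives [step]. Along [Y], [step] makes the
    weight [f \o X] interchangeable with its mean. *)
Lemma independent_ge0_integralM X Y (f h : R -> R) : independent_RV P X Y ->
  measurable_fun [set: T] X -> measurable_fun [set: T] Y ->
  measurable_fun [set: R] f -> measurable_fun [set: R] h ->
  (forall x, 0 <= f x) -> (forall x, 0 <= h x) ->
  int (f \o X) -> int (h \o Y) ->
  \int[P]_x (f (X x) * h (Y x)) = \int[P]_x f (X x) * \int[P]_x h (Y x).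
Proof.
move=> indep mX mY mf mh f0 h0 if_ ih.
have PfinE A : measurable A -> (fine (P A))%:E = P A.
  by move=> mA; rewrite fineK// fin_num_measure.
have mfX : measurable_fun [set: T] (f \o X) by exact: measurableT_comp.
have step B : measurable B ->
    (\int[P]_(x in Y @^-1` B) (f (X x))%:E =
     \int[P]_(x in Y @^-1` B) (\int[P]_x f (X x))%:E)%E.
  move=> mB; have mYB : measurable (Y @^-1` B).
    by rewrite -[_ @^-1` _]setTI; exact: mY.
  have mI : measurable_fun [set: T] (\1_(Y @^-1` B) : T -> R).
    exact: measurable_indic.
  have := @eq_integral_weighted _ _ _ T T R R P P X X (\1_(Y @^-1` B))
    (cst (fine (P (Y @^-1` B)))) f mX mX mI (measurable_cst _).
  have H1 : forall A, measurable A ->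
      (\int[P]_(x in X @^-1` A) (\1_(Y @^-1` B) x)%:E =
       \int[P]_(x in X @^-1` A) (cst (fine (P (Y @^-1` B))) x)%:E)%E.
    move=> A mA; have mXA : measurable (X @^-1` A).
      by rewrite -[_ @^-1` _]setTI; exact: mX.
    by rewrite integral_indic// (integral_cst P mXA (_%:E)) PfinE// muleC
               -indep// setIC.
  move=> /(_ _ _ H1 mf f0) => H2.
  rewrite (integral_cst P mYB (_%:E)).
  transitivity (\int[P]_x (\1_(Y @^-1` B) x * f (X x))%:E)%E.
    rewrite integral_mkcond; apply: eq_integral => x _.
    by rewrite patchE indicE; case: ifP; rewrite ?mul1r ?mul0r.
  rewrite H2//; last by move=> x; rewrite /= fine_ge0.
  rewrite -[X in _ = (_ * X)%E](PfinE _ mYB) muleC.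
  rewrite /Rintegral (fineK (integrable_fin_num measurableT if_)).
  by rewrite -(integralZl measurableT if_).
have := @eq_integral_weighted _ _ _ T T R R P P Y Y (f \o X)
  (cst (\int[P]_x f (X x))) h mY mY mfX (measurable_cst _).
move=> /(_ _ _ step mh h0) H.
rewrite /Rintegral H//=; last by move=> x; exact: Rintegral_ge0.
rewrite -/(Rintegral P setT (fun x => \int[P]_x f (X x) * h (Y x))).
by rewrite RintegralZl.
Qed.

Lemma independent_integralM X Y : independent_RV P X Y ->
  measurable_fun [set: T] X -> measurable_fun [set: T] Y ->
  int X -> int Y -> int (fun x => X x * Y x) ->
  \int[P]_x (X x * Y x) = \int[P]_x X x * \int[P]_x Y x.
Proof.
move=> indep mX mY iX iY iXY.
(* [z = (z + |z|) - |z|] reduces the claim to nonnegative functions. *)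
pose p (z : R) := z + `|z|.
have p0 z : 0 <= p z by have := ler_norm (- z); rewrite /p normrN; lra.
have n0 (z : R) : 0 <= `|z| by [].
have mn : measurable_fun [set: R] (fun z : R => `|z|).
  exact: measurableT_comp.
have mp : measurable_fun [set: R] p by exact: measurable_funD.
have inX := integrable_norm iX; have inY := integrable_norm iY.
have ipX : int (p \o X) by exact: integrable_EFinD.
have ipY : int (p \o Y) by exact: integrable_EFinD.
(* Every product in the expansion is dominated by a multiple of the integrable [X * Y]. The
   constants 4, 2 and 1 below count one factor 2 for each occurrence of [p]. *)
have iM (f h : R -> R) (c : R) : measurable_fun [set: R] f ->
    measurable_fun [set: R] h ->
    (forall a b, `|f a * h b| <= c * `|a * b|) ->
    int (fun x => f (X x) * h (Y x)).
  move=> mf mh fh; apply: integrable_EFin_le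
    (integrable_EFinZ measurableT c (integrable_norm iXY)) => //.
    by apply: measurable_funM; exact: measurableT_comp.
  by move=> x _; apply: le_trans (fh _ _) (ler_norm _).
have pn z : `|p z| <= 2 * `|z|.
  by rewrite ger0_norm ?p0//; have := ler_norm z; rewrite /p; lra.
have ipp : int (fun x => p (X x) * p (Y x)).
  apply: (iM _ _ 4) => // a b; rewrite !normrM.
  by rewrite (_ : 4 * _ = (2 * `|a|) * (2 * `|b|)); [exact: ler_pM|ring].
have ipn : int (fun x => p (X x) * `|Y x|).
  apply: (iM p _ 2) => // a b; rewrite !normrM normr_id.
  by rewrite mulrA ler_wpM2r.
have inp : int (fun x => `|X x| * p (Y x)).
  apply: (iM _ p 2) => // a b; rewrite !normrM normr_id.
  by rewrite mulrCA ler_wpM2l.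
have inn : int (fun x => `|X x| * `|Y x|).
  by apply: (iM _ _ 1) => // a b; rewrite !normrM !normr_id mul1r.
transitivity (\int[P]_x ((p (X x) * p (Y x) - p (X x) * `|Y x|)
    - (`|X x| * p (Y x) - `|X x| * `|Y x|))).
  by apply: eq_Rintegral => x _; rewrite /p; ring.
rewrite !RintegralB//; [|exact: integrable_EFinB..].
rewrite (independent_ge0_integralM indep mX mY mp mp)//.
rewrite (independent_ge0_integralM indep mX mY mp mn)//.
rewrite (independent_ge0_integralM indep mX mY mn mp)//.
rewrite (independent_ge0_integralM indep mX mY mn mn)//.
have -> : \int[P]_x p (X x) = \int[P]_x X x + \int[P]_x `|X x|.
  exact: RintegralD.
have -> : \int[P]_x p (Y x) = \int[P]_x Y x + \int[P]_x `|Y x|.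
  exact: RintegralD.
ring.
Qed.

End independence.

(** * First and second moments of the standard normal law *)

Section standard_normal_moments.
Context {R : realType}.
Local Notation mu := (@lebesgue_measure R).
Local Notation phi := (@normal_pdf R 0 1).

Let phi_ge0 x : 0 <= phi x. Proof. exact: normal_pdf_ge0. Qed.

Let phi_continuous : continuous phi.
Proof. by apply: continuous_normal_pdf; exact: oner_neq0. Qed.

Let phi_measurable : measurable_fun [set: R] phi.
Proof. exact: measurable_normal_pdf. Qed.

Let phiE x : phi x = normal_peak 1 * expR (- x ^+ 2 / 2).
Proof.
by rewrite normal_pdfE ?oner_neq0// /normal_fun subr0 expr1n.
Qed.

Let phi_even x : phi (- x) = phi x. Proof. by rewrite !phiE sqrrN. Qed.

Let phi_derive (x : R) : is_derive (x : R^o) 1 phi (- x * phi x).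
Proof.
rewrite (_ : phi = fun x => normal_peak 1 * expR (- x ^+ 2 / 2)); last first.
  by apply/funext => y; rewrite phiE.
apply: is_derive_eq; rewrite ?phiE /GRing.scale/=.
by field.
Qed.

Let mul_phi_derive (x : R) :
  is_derive (x : R^o) 1 (fun y => y * phi y) ((1 - x ^+ 2) * phi x).
Proof.
have := phi_derive x => h; apply: is_derive_eq; rewrite ?phiE /GRing.scale/=.
by field.
Qed.

Let opp_mul_phi_derive (x : R) :
  is_derive (x : R^o) 1 (fun y => - (y * phi y)) ((x ^+ 2 - 1) * phi x).
Proof.
have -> : (x ^+ 2 - 1) * phi x = - ((1 - x ^+ 2) * phi x) by ring.
exact: is_deriveN.
Qed.

Let mul_phi_cvg0 : (x * phi x) @[x --> +oo] --> (0 : R).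
Proof.
(* The upper bound comes from [expR (x ^+ 2 / 2) >= 1 + x ^+ 2 / 2], which exceeds [x ^+ 2 / 2]. *)
apply: (@squeeze_cvgr _ _ _ _ (cst 0) (fun x => normal_peak 1 * 2 * x^-1)).
- near=> x.
  have x0 : 0 < x by near: x; exact: nbhs_pinfty_gt.
  rewrite mulr_ge0 ?(ltW x0)//= phiE mulrCA -mulrA ler_wpM2l ?normal_peak_ge0//.
  have := expR_ge1Dx (x ^+ 2 / 2).
  rewrite mulNr expRN => h.
  rewrite ler_pdivrMr ?expR_gt0// mulrAC ler_pdivlMr//.
  nra.
- exact: cvg_cst.
- rewrite -[X in _ --> X](mulr0 (normal_peak 1 * 2)).
  apply: cvgM; first exact: cvg_cst.
  by apply/gtr0_cvgV0; [exact: nbhs_pinfty_gt|exact: cvg_id].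
Unshelve. all: by end_near. Qed.

Let mulr_phi_continuous (g : R -> R) : continuous g ->
  continuous (fun x : R => g x * phi x).
Proof. by move=> cg x; apply: cvgM; [exact: cg|exact: phi_continuous]. Qed.

Let sqr_phi_continuous : continuous (fun x : R => x ^+ 2 * phi x).
Proof. by apply: mulr_phi_continuous; exact: sqr_continuous. Qed.

Let measurable_EFin_continuous (D : set R) (f : R -> R) : continuous f ->
  measurable_fun D (fun x => (f x)%:E).
Proof.
move=> cf; apply/measurable_EFinP/measurable_funTS.
exact: continuous_measurable_fun.
Qed.

Let oneBsqr_continuous : continuous (fun x : R => 1 - x ^+ 2).
Proof. by move=> x; apply: cvgB; [exact: cvg_cst|exact: sqr_continuous]. Qed.

Let sqrB1_continuous : continuous (fun x : R => x ^+ 2 - 1).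
Proof. by move=> x; apply: cvgB; [exact: sqr_continuous|exact: cvg_cst]. Qed.

(* The second moment is read off the primitive [- x * phi x] of
   [(x ^+ 2 - 1) * phi x]; the sign of the latter changes at 1, which is where
   the half-line is cut. *)
Let integral01 :
  (\int[mu]_(x in `[0%R, 1%R]) ((1 - x ^+ 2) * phi x)%:E = (phi 1)%:E)%E.
Proof.
rewrite (@continuous_FTC2 _ _ (fun x : R => x * phi x))//.
- by rewrite mul1r mul0r sube0.
- by apply: continuous_subspaceT; exact: mulr_phi_continuous.
- split.
  + by move=> x _; exact: ex_derive.
  + apply: cvg_at_right_filter; apply: mulr_phi_continuous => ?.
    exact: cvg_id.
  + apply: cvg_at_left_filter; apply: mulr_phi_continuous => ?.
    exact: cvg_id.
- by move=> x _; rewrite derive1E; exact: derive_val.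
Qed.

Let integral1y :
  (\int[mu]_(x in `[1%R, +oo[) ((x ^+ 2 - 1) * phi x)%:E = (phi 1)%:E)%E.
Proof.
rewrite (@ge0_continuous_FTC2y _ _ (fun x => - (x * phi x)) _ 0)//.
- by rewrite mul1r sub0e EFinN oppeK.
- move=> x x1; rewrite mulr_ge0// subr_ge0 exprn_ege1//.
- by apply: continuous_subspaceT; exact: mulr_phi_continuous.
- by rewrite -[X in _ --> X]oppr0; apply: cvgN; exact: mul_phi_cvg0.
- by move=> x _; exact: ex_derive.
- apply: cvg_at_right_filter; apply: cvgN; apply: mulr_phi_continuous => ?.
  exact: cvg_id.
- by move=> x _; rewrite derive1E; exact: derive_val.
Qed.

Let integral_split (f : R -> R) : continuous f -> (forall x, 0 <= f x) ->
  (\int[mu]_(x in `[0%R, +oo[) (f x)%:E =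
   \int[mu]_(x in `[0%R, 1%R]) (f x)%:E +
   \int[mu]_(x in `[1%R, +oo[) (f x)%:E)%E.
Proof.
move=> cf f0.
rewrite -(integral_itv_bndo_bndc (measurable_EFin_continuous cf)).
rewrite -ge0_integral_setU//.
- congr integral; apply/seteqP; split => x /=; rewrite !in_itv/= ?andbT.
    by move=> ->; case: (ltP x 1) => ?; [left|right].
  by move=> [/andP[]//|]; apply: le_trans.
- exact: measurable_EFin_continuous.
- by move=> x _; rewrite lee_fin.
- apply/disj_setPS => x /=; rewrite !in_itv/= andbT => -[/andP[_ x1]].
  by rewrite leNgt x1.
Qed.

(** By evenness, it suffices to compare with the mass of [phi] on the half-line. Beyond 1 the second
    moment exceeds the mass by [phi 1], and on the unit interval it falls short by the same amount.
    Stated with sums of nonnegative terms, this avoids subtracting extended reals. *)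
Lemma integral_sqr_normal_pdf : (\int[mu]_x (x ^+ 2 * phi x)%:E = 1)%E.
Proof.
rewrite ge0_symfun_integralT; last 3 first.
- by move=> x; rewrite mulr_ge0// sqr_ge0.
- exact: sqr_phi_continuous.
- by move=> x /=; rewrite sqrrN phi_even.
rewrite -(integral_normal_pdf 0 (1 : R)) ge0_symfun_integralT//; last first.
  by move=> x /=; rewrite phi_even.
congr (_ * _)%E; rewrite -set_itvcy !integral_split//; last first.
  by move=> x; rewrite mulr_ge0// sqr_ge0.
have -> : (\int[mu]_(x in `[1%R, +oo[) (x ^+ 2 * phi x)%:E =
    (phi 1)%:E + \int[mu]_(x in `[1%R, +oo[) (phi x)%:E)%E.
  rewrite -integral1y -ge0_integralD//.
  - by apply: eq_integral => x _; rewrite -EFinD; congr EFin; ring.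
  - move=> x /=; rewrite in_itv/= andbT => x1.
    by rewrite lee_fin mulr_ge0// subr_ge0 exprn_ege1.
  - by apply: measurable_EFin_continuous; exact: mulr_phi_continuous.
  - by move=> x _; rewrite lee_fin.
  - exact: measurable_EFin_continuous.
rewrite addeA; congr (_ + _)%E.
rewrite -integral01 -ge0_integralD//.
- by apply: eq_integral => x _; rewrite -EFinD; congr EFin; ring.
- by move=> x _; rewrite lee_fin mulr_ge0// sqr_ge0.
- by apply: measurable_EFin_continuous; exact: sqr_phi_continuous.
- move=> x /=; rewrite in_itv/= => /andP[x0 x1].
  by rewrite lee_fin mulr_ge0// subr_ge0 exprn_ile1.
- by apply: measurable_EFin_continuous; exact: mulr_phi_continuous.
Qed.

(** Once the negative half-line is reflected onto the positive one, replacing [G] by its reflection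
    merely swaps the two halves. *)
Lemma ge0_integralT_oppr (G : R -> R) : continuous G -> (forall x, 0 <= G x) ->
  (\int[mu]_x (G x)%:E = \int[mu]_x (G (- x))%:E)%E.
Proof.
have split (H : R -> R) : continuous H -> (forall x, 0 <= H x) ->
    (\int[mu]_x (H x)%:E = \int[mu]_(x in `[0%R, +oo[) (H x)%:E +
       \int[mu]_(x in `[0%R, +oo[) (H (- x))%:E)%E.
  move=> cH H0; rewrite -(setUv `[0, +oo[%classic) ge0_integral_setU//=.
  - congr (_ + _)%E; rewrite setCitvr integral_itv_bndo_bndc; last first.
      exact: measurable_EFin_continuous.
    rewrite -{1}oppr0 ge0_integration_by_substitutionNy//.
    exact: continuous_subspaceT.
  - exact: measurableC.
  - exact: measurable_EFin_continuous.
  - by move=> x _; rewrite lee_fin.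
  - exact/disj_setPCl.
move=> cG G0; rewrite split// [RHS]split//; last first.
  by move=> x; apply: continuous_comp; [exact: oppr_continuous|exact: cG].
rewrite addeC; congr (_ + _)%E.
by apply: eq_integral => x _; rewrite opprK.
Qed.

Context {d : measure_display} {T : measurableType d} (P : probability T R).
Variable X : T -> R.
Hypothesis mX : measurable_fun [set: T] X.
Hypothesis X_normal :
  forall A, measurable A -> P (X @^-1` A) = normal_prob 0 1 A.

(** A transfer between [P] with weight 1 along [X] and Lebesgue measure with weight [phi] along the
    identity. *)
Lemma std_normal_ge0_integral (f : R -> R) : measurable_fun [set: R] f ->
  (forall x, 0 <= f x) ->
  (\int[P]_x (f (X x))%:E = \int[mu]_x (f x * phi x)%:E)%E.
Proof.
move=> mf f0.
have H A : measurable A -> (\int[P]_(x in X @^-1` A) (cst 1 x)%:E =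
    \int[mu]_(x in idfun @^-1` A) (phi x)%:E)%E.
  move=> mA; have mXA : measurable (X @^-1` A).
    by rewrite -[_ @^-1` _]setTI; exact: mX.
  by rewrite (integral_cst P mXA 1%:E) mul1e; exact: X_normal.
have mid : measurable_fun [set: measurableTypeR R] (idfun : _ -> R).
  by move=> _ A mA; rewrite setTI.
have := @eq_integral_weighted _ _ _ T _ R R P mu X idfun (cst 1) phi f mX
  mid (measurable_cst _) phi_measurable
  (fun=> ler01) phi_ge0 H mf f0.
under eq_integral do rewrite mul1r.
by under [X in _ = X -> _]eq_integral do rewrite mulrC.
Qed.

Lemma std_normal_sqr : (\int[P]_x (X x ^+ 2)%:E = 1)%E.
Proof.
rewrite (std_normal_ge0_integral (f := fun x => x ^+ 2)).
- exact: integral_sqr_normal_pdf.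
- exact: measurable_funX.
- by move=> x; exact: sqr_ge0.
Qed.

Lemma std_normal_Lfun2 : X \in Lfun P 2%:E.
Proof. by apply: Lfun2_intro => //; rewrite std_normal_sqr ltry. Qed.

(** The density formula covers only nonnegative functions, so symmetry is applied to the absolute
    value plus or minus the identity. Reflection exchanges the two, hence their expectations agree,
    and these differ by twice the mean. *)
Lemma std_normal_mean : \int[P]_x X x = 0.
Proof.
have iX := Lfun2_integrable std_normal_Lfun2.
have inX := integrable_norm iX.
have c (a : R) : continuous (fun x : R => `|x| + a * x).
  move=> x; apply: cvgD; first exact: norm_continuous.
  by apply: cvgM; [exact: cvg_cst|exact: cvg_id].
have g (a : R) x : `|a| = 1 -> 0 <= `|x| + a * x.
  by move=> a1; have := ler_norm (- (a * x)); rewrite normrN normrM a1; lra.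
have E (a : R) : `|a| = 1 ->
    (\int[P]_x (`|X x| + a * X x)%:E =
     \int[mu]_x ((`|x| + a * x) * phi x)%:E)%E.
  move=> a1; apply: (@std_normal_ge0_integral (fun x => `|x| + a * x)).
    by apply: continuous_measurable_fun; exact: c.
  by move=> x; exact: g.
have : (\int[P]_x (`|X x| + 1 * X x)%:E = \int[P]_x (`|X x| + (-1) * X x)%:E)%E.
  rewrite !E ?normrN ?normr1//.
  rewrite (@ge0_integralT_oppr (fun x => (`|x| + 1 * x) * phi x)).
  - by apply: eq_integral => x _; rewrite normrN phi_even mulrN mul1r mulN1r.
  - by apply: mulr_phi_continuous; exact: c.
  - by move=> x; rewrite mulr_ge0// g// normr1.
move=> /(congr1 fine); rewrite -!/(Rintegral _ _ _).
rewrite !RintegralD//; [|exact: integrable_EFinZ..].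
by rewrite !RintegralZl//; lra.
Qed.

End standard_normal_moments.

(** * Stability of independence *)

Section independent_RV.
Context {disp : measure_display} {T : measurableType disp} {R : realType}.
Variable P : probability T R.
Context {d1 d2 d3 d4 : measure_display} {T1 : measurableType d1}.
Context {T2 : measurableType d2} {T3 : measurableType d3}.
Context {T4 : measurableType d4}.

Lemma independent_RV_comp (X : T -> T1) (Y : T -> T2) (f : T1 -> T3)
    (g : T2 -> T4) : measurable_fun [set: T1] f -> measurable_fun [set: T2] g ->
  independent_RV P X Y -> independent_RV P (f \o X) (g \o Y).
Proof.
move=> mf mg XY A B mA mB; apply: (XY (f @^-1` A) (g @^-1` B)).
- by rewrite -[_ @^-1` _]setTI; exact: mf.
- by rewrite -[_ @^-1` _]setTI; exact: mg.
Qed.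

(** Each event of [Z] is already an event of [Y], so [Z] need not be factored as a function of
    [Y]. *)
Lemma independent_RV_sigma (X : T -> T1) (Y : T -> T2) (Z : T -> T3) :
  measurable_fun [set: g_sigma_algebra_preimageType Y] Z ->
  independent_RV P X Y -> independent_RV P X Z.
Proof.
move=> mZ XY A B mA mB.
have [C mC] := mZ measurableT B mB; rewrite !setTI => <-.
exact: XY.
Qed.

End independent_RV.

(** * Real covariances and Gram matrices *)

Section covariance_real.
Context {disp : measure_display} {T : measurableType disp} {R : realType}.
Variable P : probability T R.
Implicit Types X Y : T -> R.

Local Notation int f := (P.-integrable [set: T] (EFin \o f)).
Local Notation L2 X := (X \in Lfun P 2%:E).
Local Notation cov X Y := (fine (covariance P X Y)).

Lemma Lfun2_linear (a b : R) X Y : L2 X -> L2 Y ->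
  L2 (fun x => a * X x + b * Y x).
Proof.
move=> X2 Y2.
have -> : (fun x => a * X x + b * Y x) = (a \o* X \+ b \o* Y).
  by apply/funext => x /=; rewrite ![_ * a]mulrC ![_ * b]mulrC.
by rewrite rpredD ?lee1n//= => *; rewrite Lfun_scale ?ler1n.
Qed.

Lemma Rintegral_linear (a b : R) X Y : int X -> int Y ->
  \int[P]_x (a * X x + b * Y x) = a * \int[P]_x X x + b * \int[P]_x Y x.
Proof.
by move=> iX iY; rewrite RintegralD ?RintegralZl//; exact: integrable_EFinZ.
Qed.

Lemma fine_covarianceE X Y : L2 X -> L2 Y ->
  cov X Y = \int[P]_x (X x * Y x) - \int[P]_x X x * \int[P]_x Y x.
Proof.
move=> X2 Y2; have XY := Lfun2_mul_Lfun1 X2 Y2.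
have X1 : X \in Lfun P 1 by exact/Lfun1_integrable/Lfun2_integrable.
have Y1 : Y \in Lfun P 1 by exact/Lfun1_integrable/Lfun2_integrable.
rewrite covarianceE// fineB ?fin_numM ?expectation_fin_num//.
by rewrite fineM ?expectation_fin_num// unlock.
Qed.

Lemma fine_covariance_linearl (a b : R) X X' Y : L2 X -> L2 X' -> L2 Y ->
  cov (fun x => a * X x + b * X' x) Y = a * cov X Y + b * cov X' Y.
Proof.
move=> X2 X'2 Y2; rewrite !fine_covarianceE//; last exact: Lfun2_linear.
have iX := Lfun2_integrable X2; have iX' := Lfun2_integrable X'2.
rewrite Rintegral_linear//.
under eq_Rintegral do rewrite mulrDl -!mulrA.
rewrite (@Rintegral_linear _ _ (fun x => X x * Y x) (fun x => X' x * Y x)).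
- ring.
- exact: Lfun2_integrableM.
- exact: Lfun2_integrableM.
Qed.

Lemma fine_covariance_linear (a b a' b' : R) X X' Y Y' :
  L2 X -> L2 X' -> L2 Y -> L2 Y' ->
  cov (fun x => a * X x + b * X' x) (fun x => a' * Y x + b' * Y' x) =
  a * a' * cov X Y + a * b' * cov X Y' +
  (b * a' * cov X' Y + b * b' * cov X' Y').
Proof.
move=> X2 X'2 Y2 Y'2.
rewrite fine_covariance_linearl//; last exact: Lfun2_linear.
rewrite ![covariance P _ (fun x => _ + _)]covarianceC.
rewrite !fine_covariance_linearl// ![covariance P _ X]covarianceC.
rewrite ![covariance P _ X']covarianceC; ring.
Qed.

Lemma independent_covariance0 X Y : independent_RV P X Y -> L2 X -> L2 Y ->
  cov X Y = 0.
Proof.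
move=> XY X2 Y2; have iX := Lfun2_integrable X2; have iY := Lfun2_integrable Y2.
rewrite fine_covarianceE// (independent_integralM XY) ?subrr//.
- exact: integrable_EFin_measurable iX.
- exact: integrable_EFin_measurable iY.
- exact: Lfun2_integrableM.
Qed.

Lemma Rintegral_sum {n : nat} (f : 'I_n -> T -> R) : (forall i, int (f i)) ->
  \int[P]_x (\sum_i f i x) = \sum_i \int[P]_x f i x.
Proof.
move=> intf; rewrite /Rintegral sum_fine; last first.
  by move=> i _; exact: integrable_fin_num (intf i).
rewrite -integral_sum//.
by congr fine; apply: eq_integral => x _; rewrite sumEFin.
Qed.

Lemma integrable_EFin_sum {n : nat} (f : 'I_n -> T -> R) :
  (forall i, int (f i)) -> int (fun x => \sum_i f i x).
Proof.
move=> intf.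
have := @integrable_sum _ _ _ P setT measurableT _ (index_enum 'I_n) xpredT
  (fun i x => (f i x)%:E) (fun i _ => intf i).
by apply: eq_integrable => // x _ /=; rewrite sumEFin.
Qed.

(** The quadratic form at [v] is the expectation of the square of the combination of the [U i] with
    coefficients [v]. *)
Lemma gram_psd {n : nat} (U : 'I_n -> T -> R) : (forall i, L2 (U i)) ->
  psd (\matrix_(i, j) \int[P]_x (U i x * U j x)).
Proof.
move=> U2; split.
  apply/matrixP => i j; rewrite !mxE.
  by apply: eq_Rintegral => x _; rewrite mulrC.
move=> v; rewrite (_ : _ ord0 ord0 =
    \int[P]_x (\sum_i \sum_j v i ord0 * v j ord0 * (U i x * U j x))).
  apply: Rintegral_ge0 => x _.
  rewrite (_ : \sum_i _ = (\sum_i v i ord0 * U i x) ^+ 2) ?sqr_ge0//.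
  rewrite expr2 mulr_suml; apply: eq_bigr => i _.
  rewrite mulr_sumr; apply: eq_bigr => j _; ring.
have iU i j : int (fun x => v i ord0 * v j ord0 * (U i x * U j x)).
  apply: (integrable_EFinZ measurableT); exact: Lfun2_integrableM.
rewrite Rintegral_sum; last by move=> i; exact: integrable_EFin_sum.
rewrite mxE; transitivity (\sum_j \sum_i \int[P]_x
    (v i ord0 * v j ord0 * (U i x * U j x))).
  apply: eq_bigr => j _; rewrite mxE mulr_suml; apply: eq_bigr => i _.
  rewrite RintegralZl//; last exact: Lfun2_integrableM.
  by rewrite !mxE; ring.
rewrite exchange_big/=; apply: eq_bigr => i _.
by rewrite Rintegral_sum.
Qed.

End covariance_real.

(** * Covariance of a standard normal vector *)

Section standard_normal_vector.
Context {disp : measure_display} {T : measurableType disp} {R : realType}.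
Variables (P : probability T R) (n : nat) (X : T -> 'cV[R]_n).
Hypothesis mX : measurable_fun [set: T] X.
Hypothesis X_normal : std_normal_vec P X.

Let coord i := fun w => X w i ord0.

Let measurable_X i : measurable_fun [set: T] (coord i).
Proof. exact: measurableT_comp (measurable_coord i) mX. Qed.

Lemma std_normal_vec_coord i A : measurable A ->
  P (coord i @^-1` A) = normal_prob 0 1 A.
Proof.
(* A box that is the whole line in every other direction; those factors equal 1. *)
move=> mA; have := X_normal (A := fun k => if k == i then A else setT).
rewrite (bigD1 i)//= eqxx big1 ?mule1; last first.
  by move=> k /negbTE ->; exact: probability_setT.
rewrite (_ : [set w | _] = coord i @^-1` A); last first.
  apply/seteqP; split => w /=; first by move=> /(_ i); rewrite eqxx.
  by move=> Aw k; case: eqP => // ->.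
by apply => k; case: ifP.
Qed.

Lemma std_normal_vec_indep i j : i != j ->
  independent_RV P (coord i) (coord j).
Proof.
move=> ij A B mA mB; rewrite !std_normal_vec_coord//.
have := X_normal
  (A := fun k => if k == i then A else if k == j then B else setT).
rewrite (bigD1 i)//= eqxx (bigD1 j) 1?eq_sym//= (negbTE ij) eqxx.
rewrite big1 ?mule1; last first.
  by move=> k /andP[/negbTE -> /negbTE ->]; exact: probability_setT.
rewrite (_ : [set w | _] = coord i @^-1` A `&` coord j @^-1` B); last first.
  apply/seteqP; split => w /=.
    by move=> Xw; have := Xw i; have := Xw j; rewrite !eqxx eq_sym (negbTE ij).
  by move=> [Aw Bw] k; case: eqP => [->//|_]; case: eqP => [->|].
by apply => k; case: ifP => // _; case: ifP.
Qed.


Lemma std_normal_vec_Lfun2 : square_integrable P X.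
Proof.
move=> i; apply: (std_normal_Lfun2 (measurable_X i)).
exact: std_normal_vec_coord.
Qed.

Lemma std_normal_vec_cov i j :
  fine (covariance P (coord i) (coord j)) = (i == j)%:R.
Proof.
have [<-|ij] := eqVneq i j; last first.
  apply: independent_covariance0.
  - exact: std_normal_vec_indep.
  - exact: std_normal_vec_Lfun2.
  - exact: std_normal_vec_Lfun2.
rewrite fine_covarianceE ?std_normal_vec_Lfun2//.
rewrite (std_normal_mean (measurable_X i) (@std_normal_vec_coord i)).
rewrite mulr0 subr0.
rewrite /Rintegral; under eq_integral do rewrite -expr2.
by rewrite (std_normal_sqr (measurable_X i) (@std_normal_vec_coord i)).
Qed.

End standard_normal_vector.

(** * Covariance matrices and the law of total covariance *)

Section CPS.
Context {disp : measure_display} {T : measurableType disp} {R : realType}.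
Variables (P : probability T R) (d : nat).
Implicit Types X Z : T -> 'cV[R]_d.

Local Notation coord X i := (fun w => X w i ord0).

Lemma coord_linear (a b : R) X Z i :
  coord (fun w => a *: X w + b *: Z w) i =
  (fun w => a * coord X i w + b * coord Z i w).
Proof. by apply/funext => w; rewrite !mxE. Qed.

Lemma square_integrable_linear (a b : R) X Z :
  square_integrable P X -> square_integrable P Z ->
  square_integrable P (fun w => a *: X w + b *: Z w).
Proof. by move=> X2 Z2 i; rewrite coord_linear; exact: Lfun2_linear. Qed.

(** Serves twice: for [L], with noise [eps], and for the CPS transition, with noise [w]. *)
Lemma cov_mx_add_uncorrelated (a b : R) X Z :
  square_integrable P X -> square_integrable P Z ->
  (forall i j, fine (covariance P (coord X i) (coord Z j)) = 0) ->
  cov_mx P Z = 1%:M ->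
  cov_mx P (fun w => a *: X w + b *: Z w) =
  a ^+ 2 *: cov_mx P X + (b ^+ 2)%:M.
Proof.
move=> X2 Z2 XZ0 covZ; rewrite -[(b ^+ 2)%:M]mulmx1 mul_scalar_mx -covZ.
apply/matrixP => i j; rewrite !mxE !coord_linear fine_covariance_linear//.
by rewrite XZ0 (covarianceC _ (coord Z i)) XZ0; ring.
Qed.

Lemma cov_mx_std_normal (X : {RV P >-> 'cV[R]_d}) : std_normal_vec P X ->
  cov_mx P X = 1%:M.
Proof.
move=> XN; apply/matrixP => i j; rewrite !mxE.
by rewrite (std_normal_vec_cov _ XN).
Qed.

Context {d' : measure_display} {T' : measurableType d'}.
Variable Y : T -> T'.
Hypothesis mY : measurable_fun [set: T] Y.

Lemma cond_exp_mx_square_integrable X Z : is_cond_exp_mx P Y X Z ->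
  square_integrable P X -> square_integrable P Z.
Proof. by move=> XZ X2 i; exact: cond_exp_Lfun2 (XZ i ord0) (X2 i). Qed.

Lemma cond_exp_mx_linear (a b : R) (X1 X2 Z1 Z2 : T -> 'cV[R]_d) :
  square_integrable P X1 -> square_integrable P X2 ->
  is_cond_exp_mx P Y X1 Z1 -> is_cond_exp_mx P Y X2 Z2 ->
  is_cond_exp_mx P Y (fun w => a *: X1 w + b *: X2 w)
    (fun w => a *: Z1 w + b *: Z2 w).
Proof.
move=> X12 X22 XZ1 XZ2 i j; rewrite ord1 !coord_linear.
by apply: (cond_exp_linear mY) => //; exact: Lfun2_integrable.
Qed.

(** Conditioning preserves the mean, so the expectation of [C] is that of the outer product of the
    prediction errors, for the version [m] from which [C] is built. *)
Lemma expect_cond_cov_gram X C : is_cond_cov P Y X C ->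
  exists2 m : T -> 'cV[R]_d, is_cond_exp_mx P Y X m &
    expect_mx P C = \matrix_(i, j)
      \int[P]_w ((X w i ord0 - m w i ord0) * (X w j ord0 - m w j ord0)).
Proof.
move=> [m Xm XC]; exists m => //; apply/matrixP => i j; rewrite !mxE.
rewrite unlock -/(Rintegral P setT (fun w => C w i j)).
rewrite -(cond_exp_expectation (XC i j)).
by apply: eq_Rintegral => w _; rewrite !mxE big_ord1 !mxE.
Qed.

Lemma expect_cond_cov_psd X C : square_integrable P X ->
  is_cond_cov P Y X C -> psd (expect_mx P C).
Proof.
move=> X2 /expect_cond_cov_gram[m Xm ->].
have m2 := cond_exp_mx_square_integrable Xm X2.
apply: (@gram_psd _ _ _ P d (fun i w => X w i ord0 - m w i ord0)) => i.
have -> : (fun w => X w i ord0 - m w i ord0) =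
    (fun w => 1 * X w i ord0 + (- 1) * m w i ord0).
  by apply/funext => w; rewrite mul1r mulN1r.
exact: Lfun2_linear.
Qed.

(* [Z] need not be the version of [E[X | Y]] used in [C]. *)
Lemma total_covariance X Z C : square_integrable P X ->
  is_cond_exp_mx P Y X Z -> is_cond_cov P Y X C ->
  cov_mx P Z = cov_mx P X - expect_mx P C.
Proof.
move=> X2 XZ /expect_cond_cov_gram[m Xm ->].
have Z2 := cond_exp_mx_square_integrable XZ X2.
apply/matrixP => i j; rewrite !mxE !fine_covarianceE//.
rewrite (cond_exp_error_mul mY (X2 i) (X2 j) (Xm i ord0) (Xm j ord0)).
rewrite (cond_exp_version_mul mY (X2 i) (X2 j) (Xm i ord0) (XZ i ord0)
  (Xm j ord0) (XZ j ord0)).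
rewrite !(cond_exp_expectation (XZ _ ord0)); ring.
Qed.

Lemma trace_expect_mx_gt0 (X : T -> 'M[R]_d) (C : T -> 'M[R]_d) :
  is_cond_exp_mx P Y X C -> (0 < 'E_P[fun x => \tr (C x)])%E ->
  0 < \tr (expect_mx P C).
Proof.
move=> XC; have iC i : P.-integrable [set: T] (EFin \o (fun w => C w i i)).
  by have [] := XC i i.
have -> : \tr (expect_mx P C) = fine 'E_P[fun x => \tr (C x)].
  rewrite unlock -[RHS]/(Rintegral P setT (fun w => \sum_i C w i i)).
  by rewrite Rintegral_sum//; apply: eq_bigr => i _; rewrite mxE unlock.
(* Finiteness matters here: [fine] would send an infinite expectation to 0. It follows from the
   integrability of the diagonal entries of [C]. *)
move=> C0; rewrite fine_gt0// C0/= unlock integrable_lty//.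
exact: (integrable_EFin_sum iC).
Qed.

End CPS.

Theorem mainTheorem4 (disp : measure_display) (T : measurableType disp)
    (R : realType) (P : probability T R) (d : nat)
    (z0 eps w : {RV P >-> 'cV[R]_d}) (t t' k1 k2 : R)
    (z0_L2 : square_integrable P z0)
    (eps_normal : std_normal_vec P eps)
    (z0_eps_indep : independent_RV P z0 eps)
    (w_normal : std_normal_vec P w)
    (w_indep : independent_RV P w (fun x => (z0 x, eps x)))
    (t'_ge0 : 0 <= t') (t'_lt : t' < t) (t_le1 : t <= 1)
    (k_sum : k1 ^+ 2 + k2 ^+ 2 = t' ^+ 2) :
  let zt := fun x => (1 - t) *: z0 x + t *: eps x in
  let L := fun x => (1 - t') *: z0 x + k1 *: eps x in
  forall (z0hat epshat : T -> 'cV[R]_d) (C : T -> 'M[R]_d),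
    is_cond_exp_mx P zt z0 z0hat ->
    is_cond_exp_mx P zt eps epshat ->
    is_cond_cov P zt L C ->
  let zCPS := fun x => (1 - t') *: z0hat x + k1 *: epshat x + k2 *: w x in
  [/\ cov_mx P zCPS = cov_mx P L - expect_mx P C + (k2 ^+ 2)%:M,
      loewner_le (cov_mx P zCPS)
        ((1 - t') ^+ 2 *: cov_mx P z0 + (t' ^+ 2)%:M) &
      (0 < 'E_P[fun x => \tr (C x)])%E ->
      \tr (cov_mx P zCPS) <
        \tr ((1 - t') ^+ 2 *: cov_mx P z0 + (t' ^+ 2)%:M)].
Proof.
move=> zt L z0hat epshat C hz0 heps hC zCPS.
have mz0 : measurable_fun [set: T] z0 by [].
have meps : measurable_fun [set: T] eps by [].
have mw : measurable_fun [set: T] w by [].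
have mzt : measurable_fun [set: T] zt.
  apply: measurable_colvec => i; rewrite coord_linear.
  by apply: measurable_funD; apply: measurable_funM => //;
    exact: (measurableT_comp (measurable_coord i)).
have eps_L2 : square_integrable P eps by exact: std_normal_vec_Lfun2.
have w_L2 : square_integrable P w by exact: std_normal_vec_Lfun2.
have L_L2 : square_integrable P L by exact: square_integrable_linear.
pose Lhat x := (1 - t') *: z0hat x + k1 *: epshat x.
have hL : is_cond_exp_mx P zt L Lhat by exact: cond_exp_mx_linear.
have Lhat_L2 := cond_exp_mx_square_integrable mzt hL L_L2.
have covL : cov_mx P L = (1 - t') ^+ 2 *: cov_mx P z0 + (k1 ^+ 2)%:M.
  apply: cov_mx_add_uncorrelated => //; last exact: cov_mx_std_normal.
  move=> i j; apply: independent_covariance0 => //.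
  exact: (independent_RV_comp (measurable_coord i) (measurable_coord j)).
(* Independence descends from the pair [(z0, eps)] to its linear image [zt], then to [Lhat], which
   is measurable for the sigma-algebra of [zt]. *)
have w_Lhat i j :
    independent_RV P (fun x => w x i ord0) (fun x => Lhat x j ord0).
  have [mLhat _ _] := hL j ord0.
  apply: (independent_RV_comp (measurable_coord i) (@measurable_id _ _ setT)).
  apply: (independent_RV_sigma mLhat).
  exact: (independent_RV_comp (@measurable_id _ _ setT)
           (measurable_colvec_linear (1 - t) t) w_indep).
have covCPS : cov_mx P zCPS = cov_mx P L - expect_mx P C + (k2 ^+ 2)%:M.
  rewrite -(total_covariance mzt L_L2 hL hC).
  have -> : zCPS = (fun x => 1 *: Lhat x + k2 *: w x).
    by apply/funext => x; rewrite scale1r.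
  rewrite cov_mx_add_uncorrelated ?expr1n ?scale1r//.
  - by move=> i j; rewrite covarianceC independent_covariance0.
  - exact: cov_mx_std_normal.
have gap : (1 - t') ^+ 2 *: cov_mx P z0 + (t' ^+ 2)%:M - cov_mx P zCPS =
    expect_mx P C.
  rewrite covCPS covL -k_sum raddfD/=.
  by apply/matrixP => i j; rewrite !mxE; ring.
split=> //.
- by rewrite /loewner_le gap; exact: (expect_cond_cov_psd mzt L_L2 hC).
- move=> C0; have [m _ mC] := hC.
  rewrite -subr_gt0 -raddfB/= gap; exact: (trace_expect_mx_gt0 mC C0).
Qed.
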